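(* Let $K$ be a field of characteristic $p>0$ and let $\Gamma\subseteq\mathbb{R}$ be an additive subgroup such that $\Gamma/p\Gamma$ is infinite. Let $M=K((t^{p\Gamma}))\cdot K(t^\Gamma)\subseteq K((t^\Gamma))$ be the compositum, with the norm induced from $K((t^\Gamma))$. Then: (i) there is a bounded sequence $(r_i)_{i\ge0}$ of elements of $\Gamma$ lying in pairwise distinct cosets of $p\Gamma$; (ii) $M$ is an algebraic extension of $K((t^{p\Gamma}))$ and consists exactly of those Hahn series in $K((t^\Gamma))$ whose exponents lie in finitely many cosets of $p\Gamma$ in $\Gamma$; (iii) the completion $\widehat M$ of $M$ is not spherically complete; (iv) there is no nonzero continuous $\widehat M$-linear map $\widehat M^{1/p}\to\widehat M$.
   Context: For a field $K$ and an additive subgroup $\Gamma\subseteq\mathbb{R}$: $K[t^\Gamma]$ is the ring of finite sums $\sum_{\gamma\in\Gamma}a_\gamma t^\gamma$ ($a_\gamma\in K$), $K(t^\Gamma)$ its fraction field, and $K((t^\Gamma))$ the Hahn series field of formal sums $\sum_{\gamma\in\Gamma}a_\gamma t^\gamma$ whose support $\{\gamma: a_\gamma\ne0\}$ is well-ordered, with the usual multiplication. These are valued by $\|\sum a_\gamma t^\gamma\|=\max_{a_\gamma\neq0}e^{-\gamma}$ (and $\|0\|=0$), a non-Archimedean absolute value; $K(t^\Gamma)\subseteq K((t^\Gamma))$ compatibly, and $K((t^{p\Gamma}))\subseteq K((t^\Gamma))$. A complete valued field is spherically complete if every decreasing sequence of closed disks has nonempty intersection. $\widehat M^{1/p}$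 carries the unique absolute value extending that of $\widehat M$; continuity refers to metric topologies. *)

(* Defs.v *)
From mathcomp Require Import all_boot all_order all_algebra.
From Stdlib Require Import Reals ClassicalEpsilon List.
Set Implicit Arguments. Unset Strict Implicit. Unset Printing Implicit Defensive.

Open Scope R_scope.

Section Hahn.
Variable K : fieldType.

Definition pmul_grp (p : nat) (G : R -> Prop) : R -> Prop :=
  fun x => exists g, G g /\ x = INR p * g.

Definition add_subgroup (G : R -> Prop) : Prop :=
  G R0 /\ (forall x y, G x -> G y -> G (x + y)) /\ (forall x, G x -> G (- x)).

Definition covered_by_cosets (H : R -> Prop) (l : list R) (A : R -> Prop) : Prop :=
  forall x, A x -> exists r, In r l /\ H (x - r).

Definition hahn (G : R -> Prop) (f : R -> K) : Prop :=
  (forall x, f x <> GRing.zero -> G x) /\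
  (forall S : R -> Prop, (forall x, S x -> f x <> GRing.zero) ->
     (exists x, S x) -> exists m, S m /\ forall x, S x -> m <= x).

Definition hpoly (G : R -> Prop) (f : R -> K) : Prop :=
  (forall x, f x <> GRing.zero -> G x) /\
  exists l : list R, forall x, f x <> GRing.zero -> In x l.

Definition hzero : R -> K := fun _ => GRing.zero.
Definition hone : R -> K :=
  fun x => if Req_EM_T x R0 then GRing.one K else GRing.zero.
Definition hadd (f g : R -> K) : R -> K := fun x => GRing.add (f x) (g x).
Definition hopp (f : R -> K) : R -> K := fun x => GRing.opp (f x).
Definition hsub (f g : R -> K) : R -> K := hadd f (hopp g).

(* Cauchy product: (f g)(x) = sum_{a+b=x} f a g b, a finite sum for Hahn series *)
Definition hmul (f g : R -> K) : R -> K := fun x =>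
  match excluded_middle_informative
          (exists l : list R, NoDup l /\
             forall a, (f a <> GRing.zero /\ g (x - a) <> GRing.zero) <-> In a l)
  with
  | left H =>
      let l := proj1_sig (constructive_indefinite_description _ H) in
      foldr GRing.add GRing.zero (map (fun a => GRing.mul (f a) (g (x - a))) l)
  | right _ => GRing.zero
  end.

Fixpoint hpow (f : R -> K) (n : nat) : R -> K :=
  match n with O => hone | S n => hmul f (hpow f n) end.

Definition hhorner (cs : list (R -> K)) (f : R -> K) : R -> K :=
  foldr (fun c acc => hadd c (hmul acc f)) hzero cs.

Definition hval (f : R -> K) : R :=
  epsilon (inhabits R0) (fun m => f m <> GRing.zero /\
                                 forall x, f x <> GRing.zero -> m <= x).

Definition hnorm (f : R -> K) : R :=
  if excluded_middle_informative (forall x, f x = GRing.zero) then R0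
  else exp (- hval f).

Definition hsubfield (G : R -> Prop) (S : (R -> K) -> Prop) : Prop :=
  (forall f, S f -> hahn G f) /\ S hzero /\ S hone /\
  (forall f g, S f -> S g -> S (hadd f g)) /\
  (forall f, S f -> S (hopp f)) /\
  (forall f g, S f -> S g -> S (hmul f g)) /\
  (forall f g, S f -> f <> hzero -> hahn G g -> hmul f g = hone -> S g).

Definition hrat (G : R -> Prop) (h : R -> K) : Prop :=
  exists f g, hpoly G f /\ hpoly G g /\ g <> hzero /\ hahn G h /\ hmul g h = f.

Definition compositum (p : nat) (G : R -> Prop) (f : R -> K) : Prop :=
  forall S, hsubfield G S ->
    (forall g, hahn (pmul_grp p G) g -> S g) ->
    (forall h, hrat G h -> S h) -> S f.

(* completion of M, realised as the closure of M in the complete field K((t^G)) *)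
Definition closure_in (G : R -> Prop) (A : (R -> K) -> Prop) (f : R -> K) : Prop :=
  hahn G f /\ forall eps, R0 < eps -> exists m, A m /\ hnorm (hsub f m) < eps.

Definition spherically_complete (A : (R -> K) -> Prop) : Prop :=
  forall (c : nat -> R -> K) (r : nat -> R),
    (forall n, A (c n)) -> (forall n, R0 <= r n) ->
    (forall n x, A x -> hnorm (hsub x (c (S n))) <= r (S n) ->
                        hnorm (hsub x (c n)) <= r n) ->
    exists x, A x /\ forall n, hnorm (hsub x (c n)) <= r n.

(* A^{1/p} is modelled via Frobenius: the element x^{1/p} (x in A) is
   represented by x itself; addition is that of A, the A-scalar action is
   a . x^{1/p} = (a^p x)^{1/p}, and the extended absolute value is
   || x^{1/p} || = ||x||^{1/p}.  A continuous A-linear map A^{1/p} -> A is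
   thus a map L on A with the properties below. *)
Definition cont_linear_root_map (p : nat) (A : (R -> K) -> Prop)
    (L : (R -> K) -> (R -> K)) : Prop :=
  (forall x, A x -> A (L x)) /\
  (forall x y, A x -> A y -> L (hadd x y) = hadd (L x) (L y)) /\
  (forall a x, A a -> A x -> L (hmul (hpow a p) x) = hmul a (L x)) /\
  (forall x, A x -> forall eps, R0 < eps -> exists delta, R0 < delta /\
     forall y, A y -> Rpower (hnorm (hsub y x)) (/ INR p) < delta ->
               hnorm (hsub (L y) (L x)) < eps).

End Hahn.

(* Main.v *)
Require Import Defs.
From Stdlib Require Import Reals ClassicalEpsilon List Lra.
From HB Require Import structures.
From mathcomp Require Import all_boot all_algebra.
From mathcomp Require Import boolp classical_sets cardinality fsbigop.
Set Implicit Arguments. Unset Strict Implicit. Unset Printing Implicit Defensive.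
Import GRing.Theory.
Delimit Scope R_scope with coqR.
Local Open Scope classical_set_scope.
Local Open Scope R_scope.

(** The p-th power of a Hahn series u over G has its exponents in pG. Hence u is
    a root of X^p - u^p, and division by u reduces to division by u^p, which
    respects the decomposition of a series along the cosets of pG. This identifies
    M with the series whose exponents lie in finitely many cosets, and its
    completion with the series that have this property below every bound.

    As G/pG is infinite, pG is dense in R, so there is a bounded increasing
    sequence (s_n) of pairwise incongruent elements of G. No element of the
    completion of M has all the s_n as exponents; in particular the partial sums of
    the series with terms t^(s_n) have no pseudo-limit there.

    For a continuous linear map L and x in the completion, y |-> L (y x^(1/p)) is
    defined on the whole of K((t^G)), where pseudo-limits exist. If it did not
    vanish, a sequence almost realising its operator norm would have a pseudo-limit
    whose image has all the s_n as exponents. *)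

HB.instance Definition _ := gen_eqMixin R.
HB.instance Definition _ := gen_choiceMixin R.

Lemma InP (T : eqType) (x : T) (s : seq T) : reflect (In x s) (x \in s).
Proof.
elim: s => [|y s IHs]; first by constructor.
rewrite inE eq_sym; apply: (iffP orP) => -[/eqP|/IHs]; by [left|right].
Qed.

Lemma NoDup_uniq (T : eqType) (s : seq T) : NoDup s <-> uniq s.
Proof.
elim: s => [|x s IHs] /=; first by split=> // _; constructor.
by rewrite NoDup_cons_iff IHs; split=> [[/InP -> ->]|/andP[/InP]].
Qed.

Lemma history_choice (T : Type) (P : seq T -> T -> Prop) :
  (forall s, exists x, P s x) -> exists f : nat -> T, forall n, P (mkseq f n) (f n).
Proof.
move=> /choice[next nextP].
pose history n := iter n (fun s => rcons s (next s)) [::].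
exists (next \o history) => n; suff -> : mkseq (next \o history) n = history n by [].
by elim: n => // n IHn; rewrite mkseqS IHn.
Qed.

Lemma exchange_fsbigT (V : Type) (idx : V) (op : Monoid.com_law idx)
    (I J : choiceType) (A : set I) (B : set J) (F : I -> J -> V) :
    finite_set A -> finite_set B -> (forall i j, F i j <> idx -> A i /\ B j) ->
  \big[op/idx]_(i \in setT) \big[op/idx]_(j \in setT) F i j =
  \big[op/idx]_(j \in setT) \big[op/idx]_(i \in setT) F i j.
Proof.
move=> finA finB supF.
have F_A i j : ~ A i -> F i j = idx by apply: contra_notP => /supF[].
have F_B i j : ~ B j -> F i j = idx by apply: contra_notP => /supF[].
have rowE i : \big[op/idx]_(j \in B) F i j = \big[op/idx]_(j \in setT) F i j.
  by apply: fsbig_widen => // j [_ nBj]; exact: F_B.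
have colE j : \big[op/idx]_(i \in A) F i j = \big[op/idx]_(i \in setT) F i j.
  by apply: fsbig_widen => // i [_ nAi]; exact: F_A.
rewrite -(fsbig_widen A) //; last first.
  by move=> i [_ nAi]; apply: fsbig1 => j _; exact: F_A.
rewrite -[RHS](fsbig_widen B) //; last first.
  by move=> j [_ nBj]; apply: fsbig1 => i _; exact: F_B.
under eq_fsbigr do rewrite -rowE; under [RHS]eq_fsbigr do rewrite -colE.
exact: exchange_fsbig.
Qed.

(** * Well-ordered sets of reals *)

Definition least (S : set R) (m : R) := S m /\ forall x, S x -> m <= x.

Definition well_ordered (S : set R) :=
  forall T : set R, T `<=` S -> T !=set0 -> exists m, least T m.

Definition fiber (S T : set R) (x : R) : set R := [set a | S a /\ T (x - a)].

Definition sumset (S T : set R) : set R := [set x | fiber S T x !=set0].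

Lemma well_orderedS (S T : set R) : S `<=` T -> well_ordered T -> well_ordered S.
Proof. by move=> sST woT U /subset_trans /(_ sST); apply: woT. Qed.

Lemma well_ordered_ind (S : set R) (P : R -> Prop) : well_ordered S ->
  (forall a, S a -> (forall c, S c -> c < a -> P c) -> P a) -> forall a, S a -> P a.
Proof.
move=> woS IH a Sa; apply: contrapT => nPa.
have [||m [[Sm nPm] m_min]] := woS (S `&` ~` P); [by move=> x []|by exists a|].
apply: nPm; apply: IH => // c Sc c_lt_m; apply: contrapT => nPc.
by have := m_min c (conj Sc nPc); lra.
Qed.

Lemma well_orderedU (S T : set R) :
  well_ordered S -> well_ordered T -> well_ordered (S `|` T).
Proof.
move=> woS woT U sU U0; have [US0|nUS] := pselect (U `&` S !=set0); last first.
  by apply: woT => // x Ux; case: (sU x Ux) => // Sx; case: nUS; exists x.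
have [m [[Um Sm] m_min]] := woS _ (@subIsetr _ U S) US0.
have [lt0|nlt] := pselect (U `&` [set x | x < m] !=set0); last first.
  by exists m; split=> // x Ux; apply: Rnot_lt_le => lt_xm; apply: nlt; exists x.
have [|n [[Un lt_nm] n_min]] := woT _ _ lt0.
  move=> x [Ux /= lt_xm]; case: (sU x Ux) => // Sx.
  by have := m_min x (conj Ux Sx); lra.
exists n; split=> // x Ux; have [lt_xm|] := Rlt_dec x m; first exact: n_min.
by move: lt_nm => /=; lra.
Qed.

Lemma well_ordered1 (a : R) : well_ordered [set a].
Proof.
by move=> T sT [x Tx]; exists x; split=> // y Ty; rewrite (sT x Tx) (sT y Ty); lra.
Qed.

Lemma well_ordered_seq (s : seq R) : well_ordered [set` s].
Proof.
elim: s => [|a s IHs]; first by move=> T sT [x /sT].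
apply: well_orderedS (well_orderedU (@well_ordered1 a) IHs) => x /=.
by rewrite inE => /orP[/eqP ->|]; [left|right].
Qed.

Lemma well_ordered_opp_finite (S : set R) :
  well_ordered S -> well_ordered [set x | S (- x)] -> finite_set S.
Proof.
move=> woS woN.
have finite_bounded (T : set R) : T `<=` S ->
    (forall c, T c -> finite_set (S `&` [set x | x < c])) -> finite_set T.
  move=> sTS fin_lt; have [T0|nT] := pselect (T !=set0); last first.
    by apply: (@sub_finite_set _ _ set0) => // x Tx; case: nT; exists x.
  have [||m [Tm m_max]] := woN [set x | T (- x)].
  - by move=> x /sTS.
  - by case: T0 => x Tx; exists (- x); rewrite /= Ropp_involutive.
  apply: (@sub_finite_set _ _ ((S `&` [set x | x < - m]) `|` [set - m])).
    move=> x Tx; have := m_max (- x); rewrite /= Ropp_involutive => /(_ Tx) le_mx.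
    have [->|ne_xm] := pselect (x = - m); first by right.
    by left; split; [exact: sTS | rewrite /=; lra].
  by rewrite finite_setU; split; [exact: fin_lt | exact: finite_set1].
apply: (finite_bounded) => //; apply: (well_ordered_ind woS) => a Sa IH.
by apply: finite_bounded => [x []|c [Sc /= /(IH _ Sc)]].
Qed.

Lemma finite_fiber (S T : set R) (x : R) :
  well_ordered S -> well_ordered T -> finite_set (fiber S T x).
Proof.
move=> woS woT; apply: well_ordered_opp_finite; first by apply: well_orderedS woS => a [].
move=> U sU [u Uu].
have [||m [Um m_min]] := woT [set b | U (b - x)].
- move=> b /sU[_]; suff -> : x - - (b - x) = b by []; ring.
- by exists (u + x); rewrite /= (_ : u + x - x = u) //; ring.
exists (m - x); split=> // y Uy; suff: m <= y + x by lra.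
by apply: m_min; rewrite /= (_ : y + x - x = y) //; ring.
Qed.

(* Among the decompositions a + b of elements of W choose one with b least:
   the elements of W below a + b then have a smaller S-component than a. *)
Lemma well_ordered_sumset (S T : set R) :
  well_ordered S -> well_ordered T -> well_ordered (sumset S T).
Proof.
move=> woS woT.
pose lowest (W : set R) a b :=
  [/\ T b, W (a + b) & forall c d, S c -> T d -> W (c + d) -> b <= d].
have lowest_ex (W : set R) : W `<=` sumset S T -> W !=set0 ->
    exists2 a, S a & exists b, lowest W a b.
  move=> sW [x Wx]; have [a [Sa Ta]] := sW x Wx.
  have [||b [[Tb [c Sc Wcb]] b_min]] := woT (T `&` [set b | exists2 c, S c & W (c + b)]).
  - by move=> b [].
  - by exists (x - a); split=> //; exists a => //; rewrite (_ : a + (x - a) = x) //; ring.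
  exists c => //; exists b; split=> // c' d Sc' Td Wd.
  by apply: b_min; split=> //; exists c'.
have lowest_least a : S a ->
    forall W b, W `<=` sumset S T -> lowest W a b -> exists m, least W m.
  move: a; apply: (well_ordered_ind woS) => a Sa IH W b sW [Tb Wab b_min].
  pose V := W `&` [set x | x < a + b].
  have [V0|nV] := pselect (V !=set0); last first.
    exists (a + b); split=> // x Wx; apply: Rnot_lt_le => lt_x; apply: nV.
    by exists x.
  have sV : V `<=` sumset S T by move=> x [/sW].
  have [c Sc [d [Td [Wcd /= lt_cd] d_min]]] := lowest_ex V sV V0.
  have lt_ca : c < a by have := b_min c d Sc Td Wcd; lra.
  have [m [[Wm /= lt_m] m_min]] := IH c Sc lt_ca V d sV (And3 Td (conj Wcd lt_cd) d_min).
  exists m; split=> // x Wx; have [lt_x|] := Rlt_dec x (a + b); last lra.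
  exact: m_min.
move=> W sW /(lowest_ex W sW)[a Sa [b /(lowest_least a Sa W b sW)]]; exact.
Qed.

Lemma well_ordered_iter_sumset (S : set R) n :
  well_ordered S -> well_ordered (iter n (sumset S) [set R0]).
Proof.
by move=> woS; elim: n => [|n IHn]; [apply: well_ordered1 | apply: well_ordered_sumset].
Qed.

Lemma iter_sumset1 (S : set R) (a : R) n x : S `<=` [set a] ->
  iter n (sumset S) [set R0] x -> x = INR n * a.
Proof.
move=> Sa; elim: n x => [|n IHn] x; first by move=> /= ->; rewrite Rmult_0_l.
by rewrite S_INR => -[b [/Sa /= -> /IHn]]; lra.
Qed.

(** * Hahn series *)

(* Bundled, so that the ring structure of K((t^G)) can be inferred from G. *)
Record subgroup := Subgroup {
  subgroup_set :> R -> Prop;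
  subgroupP : add_subgroup subgroup_set
}.

Section Subgroup.
Variable G : subgroup.
Implicit Types x y : R.

Lemma subgroup0 : G 0.
Proof. by case: (subgroupP G). Qed.

Lemma subgroupD x y : G x -> G y -> G (x + y).
Proof. by case: (subgroupP G) => _ [GD _]; apply: GD. Qed.

Lemma subgroupN x : G x -> G (- x).
Proof. by case: (subgroupP G) => _ [_ GN]; apply: GN. Qed.

Lemma subgroupB x y : G x -> G y -> G (x - y).
Proof. by move=> Gx Gy; apply: subgroupD => //; apply: subgroupN. Qed.

Lemma subgroup_natmul n x : G x -> G (INR n * x).
Proof.
move=> Gx; elim: n => [|n IHn]; first by rewrite Rmult_0_l; apply: subgroup0.
by rewrite S_INR Rmult_plus_distr_r Rmult_1_l; apply: subgroupD.
Qed.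

Lemma subgroup_intmul (z : Z) x : G x -> G (IZR z * x).
Proof.
move=> Gx; case: z => [|q|q]; first by rewrite Rmult_0_l; apply: subgroup0.
  by rewrite /IZR -INR_IPR; apply: subgroup_natmul.
by rewrite /IZR -INR_IPR -Ropp_mult_distr_l; apply/subgroupN/subgroup_natmul.
Qed.

End Subgroup.

Lemma pmul_grp_subgroup (p : nat) (G : subgroup) : add_subgroup (pmul_grp p G).
Proof.
split; first by exists 0; split; [exact: subgroup0 | ring].
split=> [_ _ [x [Gx ->]] [y [Gy ->]]|_ [x [Gx ->]]].
- by exists (x + y); split; [exact: subgroupD | ring].
- by exists (- x); split; [exact: subgroupN | ring].
Qed.

Definition pmul_subgroup (p : nat) (G : subgroup) : subgroup :=
  Subgroup (pmul_grp_subgroup p G).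

Lemma pmul_subgroup_sub (p : nat) (G : subgroup) x : pmul_subgroup p G x -> G x.
Proof. by case=> g [Gg ->]; apply: subgroup_natmul. Qed.

Section Convolution.
Variable K : fieldType.
Implicit Types (f g h : R -> K) (a x : R).

Definition supp f : set R := [set x | f x <> 0%R].

Definition hmono a : R -> K := fun x => if Req_EM_T x a then 1%R else 0%R.

Lemma nsuppP f x : ~ supp f x <-> f x = 0%R.
Proof. by split=> [/contrapT|fx0 /(_ fx0)]. Qed.

Lemma supp_hzero : supp (hzero K) = set0.
Proof. by rewrite -subset0 => x. Qed.

Lemma supp_hmono a : supp (hmono a) = [set a].
Proof.
apply/seteqP; split=> x; rewrite /supp /hmono /=; case: Req_EM_T => //=.
by move=> _ _; apply/eqP; rewrite oner_eq0.
Qed.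

Lemma supp_hadd f g : supp (hadd f g) `<=` supp f `|` supp g.
Proof.
move=> x; apply: contra_notP => /not_orP[/nsuppP fx0 /nsuppP gx0].
by rewrite /hadd fx0 gx0 addr0.
Qed.

Lemma supp_hopp f : supp (hopp f) = supp f.
Proof.
by apply/seteqP; split=> x; rewrite /supp /= /hopp => fx0 e; apply: fx0;
  [rewrite e oppr0 | rewrite -[f x]opprK e oppr0].
Qed.

Lemma hmulE f g x : hmul f g x = (\sum_(a \in setT) f a * g (x - a)%coqR)%R.
Proof.
have supportE : setT `&` (fun a => f a * g (x - a)%coqR)%R @^-1` [set~ 0%R] =
    fiber (supp f) (supp g) x.
  rewrite setTI; apply/seteqP; split=> a; rewrite /fiber /supp /preimage /=.
    by move=> fg0; split=> e; apply: fg0; rewrite e (mul0r, mulr0).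
  by move=> [/eqP fa0 /eqP ga0]; apply/eqP; rewrite mulf_neq0.
rewrite /hmul; case: excluded_middle_informative => [fin|inf]; last first.
  rewrite fsbig_dflt // supportE => /finite_seqP[s fiberE]; apply: inf; exists (undup s).
  split; first exact/NoDup_uniq/undup_uniq.
  move=> a; rewrite -[_ /\ _]/(fiber (supp f) (supp g) x a) fiberE /= -mem_undup.
  by split=> /InP.
case: ClassicalEpsilon.constructive_indefinite_description => /= l [/NoDup_uniq l_uniq lP].
rewrite (fsbigE l) //; last first.
  move=> a _ /InP/lP al; apply: contrapT => fga.
  by apply: al; rewrite -[_ /\ _]/(fiber (supp f) (supp g) x a) -supportE.
under [RHS]eq_bigl do rewrite in_setT.
by elim: l {l_uniq lP} => [|a l IHl]; rewrite ?big_nil // big_cons -IHl.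
Qed.

Lemma hmulE_fiber f g x (A : set R) : fiber (supp f) (supp g) x `<=` A ->
  hmul f g x = (\sum_(a \in A) f a * g (x - a)%coqR)%R.
Proof.
move=> sA; rewrite hmulE; apply/esym/fsbig_widen => // a [_ nAa] /=.
apply: contrapT => fg0; apply: nAa; apply: sA.
by split=> e; apply: fg0; rewrite e (mul0r, mulr0).
Qed.

Lemma supp_hmul f g : supp (hmul f g) `<=` sumset (supp f) (supp g).
Proof.
move=> x; apply: contra_notP => /nonemptyPn fiber0.
by rewrite (@hmulE_fiber _ _ _ set0) ?fsbig_set0 ?fiber0.
Qed.

Lemma hmulC f g : hmul f g = hmul g f.
Proof.
apply: funext => x; have subK a : x - (x - a) = a by ring.
rewrite !hmulE (reindex_fsbigT (fun a => x - a)); last by exists (fun a => x - a).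
by apply: eq_fsbigr => a _; rewrite subK mulrC.
Qed.

Lemma hmul_hmono a f x : hmul (hmono a) f x = f (x - a).
Proof.
rewrite (@hmulE_fiber _ _ _ [set a]); last by move=> b []; rewrite supp_hmono.
by rewrite fsbig_set1 /hmono; case: Req_EM_T => //= _; rewrite mul1r.
Qed.

Lemma hmul1f f : hmul (hone K) f = f.
Proof. by apply: funext => x; rewrite -[hone K]/(hmono 0) hmul_hmono Rminus_0_r. Qed.

Lemma hmulDl f g h :
  well_ordered (supp f) -> well_ordered (supp g) -> well_ordered (supp h) ->
  hmul (hadd f g) h = hadd (hmul f h) (hmul g h).
Proof.
move=> wof wog woh; apply: funext => x.
pose A := fiber (supp f `|` supp g) (supp h) x.
have finA : finite_set A by apply: finite_fiber => //; apply: well_orderedU.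
have fiberA k : supp k `<=` supp f `|` supp g -> fiber (supp k) (supp h) x `<=` A.
  by move=> sk a [/sk].
rewrite /hadd !(@hmulE_fiber _ _ _ A);
  [|exact/fiberA/subsetUr|exact/fiberA/subsetUl|exact/fiberA/supp_hadd].
by rewrite -fsbig_split //; apply: eq_fsbigr => a _; exact: mulrDl.
Qed.

Lemma hmulA f g h :
  well_ordered (supp f) -> well_ordered (supp g) -> well_ordered (supp h) ->
  hmul f (hmul g h) = hmul (hmul f g) h.
Proof.
move=> wof wog woh; apply: funext => x.
pose term a c := (f a * (g (c - a)%coqR * h (x - c)%coqR))%R.
have inner a : (f a * hmul g h (x - a)%coqR = \sum_(c \in setT) term a c)%R.
  rewrite hmulE mulr_fsumr (reindex_fsbigT (fun c => c - a)); last first.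
    by exists (fun c => c + a) => c; ring.
  by apply: eq_fsbigr => c _; rewrite (_ : x - a - (c - a) = x - c) //; ring.
have outer c : (hmul f g c * h (x - c)%coqR = \sum_(a \in setT) term a c)%R.
  by rewrite hmulE mulr_fsuml; apply: eq_fsbigr => a _; rewrite /term mulrA.
rewrite hmulE [RHS]hmulE; under eq_fsbigr do rewrite inner.
under [RHS]eq_fsbigr do rewrite outer.
apply: exchange_fsbigT (finite_fiber x wof (well_ordered_sumset wog woh))
  (finite_fiber x (well_ordered_sumset wof wog) woh) _ => a c term0.
have [fa gca hxc] : [/\ supp f a, supp g (c - a) & supp h (x - c)].
  by split=> e; apply: term0; rewrite /term e ?mul0r ?mulr0 ?mul0r.
split; split=> //; [exists (c - a)|exists a]; split=> //.
by rewrite (_ : x - a - (c - a) = x - c) //; ring.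
Qed.

End Convolution.

Section HahnRing.
Variables (K : fieldType) (G : subgroup).

Record hser := Hser { hcoef :> R -> K; hserP : hahn G hcoef }.

Implicit Types (f g : R -> K) (u v w : hser) (a x : R).

Lemma hser_supp u : supp u `<=` G.
Proof. by case: (hserP u). Qed.

Lemma hser_well_ordered u : well_ordered (supp u).
Proof. by case: (hserP u). Qed.

Lemma hser_eq u v : hcoef u = hcoef v -> u = v.
Proof.
case: u v => [f hf] [g hg] /= efg.
by case: _ / efg hg => hg; rewrite (Prop_irrelevance hf hg).
Qed.

Lemma hahnE f : hahn G f = (supp f `<=` G /\ well_ordered (supp f)).
Proof. by []. Qed.

Lemma hahn_hmono a : G a -> hahn G (hmono K a).
Proof. by move=> Ga; rewrite hahnE supp_hmono; split=> [x ->|] //; apply: well_ordered1. Qed.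

Lemma hahn_hzero : hahn G (hzero K).
Proof. by rewrite hahnE supp_hzero; split=> [x|T sT [x /sT]]. Qed.

Lemma hahn_hone : hahn G (hone K).
Proof. exact/hahn_hmono/subgroup0. Qed.

Lemma hahn_hadd u v : hahn G (hadd u v).
Proof.
rewrite hahnE; split; first by move=> x /supp_hadd[/hser_supp|/hser_supp].
apply: well_orderedS (@supp_hadd _ u v) _.
by apply: well_orderedU; apply: hser_well_ordered.
Qed.

Lemma hahn_hopp u : hahn G (hopp u).
Proof. by rewrite hahnE supp_hopp; apply: hserP. Qed.

Lemma hahn_hmul u v : hahn G (hmul u v).
Proof.
rewrite hahnE; split=> [x /supp_hmul[a [/hser_supp Ga /hser_supp Gxa]]|].
  by rewrite (_ : x = a + (x - a)); [apply: subgroupD | ring].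
apply: well_orderedS (@supp_hmul _ u v) _.
by apply: well_ordered_sumset; apply: hser_well_ordered.
Qed.

HB.instance Definition _ := gen_eqMixin hser.
HB.instance Definition _ := gen_choiceMixin hser.

Definition hser_add u v : hser := Hser (hahn_hadd u v).
Definition hser_opp u : hser := Hser (hahn_hopp u).
Definition hser_mul u v : hser := Hser (hahn_hmul u v).

Lemma hser_addA : associative hser_add.
Proof. by move=> u v w; apply/hser_eq/funext => x; apply: addrA. Qed.

Lemma hser_addC : commutative hser_add.
Proof. by move=> u v; apply/hser_eq/funext => x; apply: addrC. Qed.

Lemma hser_add0 : left_id (Hser hahn_hzero) hser_add.
Proof. by move=> u; apply/hser_eq/funext => x; apply: add0r. Qed.

Lemma hser_addN : left_inverse (Hser hahn_hzero) hser_opp hser_add.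
Proof. by move=> u; apply/hser_eq/funext => x; apply: addNr. Qed.

HB.instance Definition _ :=
  GRing.isZmodule.Build hser hser_addA hser_addC hser_add0 hser_addN.

Lemma hser_mulA : associative hser_mul.
Proof. by move=> u v w; apply/hser_eq/hmulA; apply: hser_well_ordered. Qed.

Lemma hser_mulC : commutative hser_mul.
Proof. by move=> u v; apply/hser_eq/hmulC. Qed.

Lemma hser_mul1 : left_id (Hser hahn_hone) hser_mul.
Proof. by move=> u; apply/hser_eq/hmul1f. Qed.

Lemma hser_mulDl : left_distributive hser_mul hser_add.
Proof. by move=> u v w; apply/hser_eq/hmulDl; apply: hser_well_ordered. Qed.

Lemma hone_neq0 : hone K <> hzero K.
Proof.
have supp1 : supp (hone K) = [set R0] := supp_hmono K 0.
by move=> e; have : supp (hone K) 0; [rewrite supp1 | rewrite e supp_hzero].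
Qed.

Lemma hser_one_neq0 : Hser hahn_hone != Hser hahn_hzero.
Proof. by apply/eqP => /(congr1 hcoef) /hone_neq0. Qed.

HB.instance Definition _ := GRing.Zmodule_isComNzRing.Build hser
  hser_mulA hser_mulC hser_mul1 hser_mulDl hser_one_neq0.

Local Open Scope ring_scope.

Definition tpow a (Ga : G a) : hser := Hser (hahn_hmono Ga).

Lemma hcoefD u v : hcoef (u + v) = hadd u v. Proof. by []. Qed.
Lemma hcoefB u v : hcoef (u - v) = hsub u v. Proof. by []. Qed.
Lemma hcoefM u v : hcoef (u * v) = hmul u v. Proof. by []. Qed.

Lemma hcoefX u n : hcoef (u ^+ n) = hpow u n.
Proof. by elim: n => // n IHn; rewrite exprS hcoefM IHn. Qed.

Lemma coefDE u v x : (u + v) x = u x + v x. Proof. by []. Qed.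
Lemma coefBE u v x : (u - v) x = u x - v x. Proof. by []. Qed.

Lemma coef_sumE (I : Type) (r : seq I) (P : pred I) (F : I -> hser) x :
  (\sum_(i <- r | P i) F i) x = \sum_(i <- r | P i) F i x.
Proof. by elim/big_rec2: _ => // i y z _ <-. Qed.

Lemma supp0 : supp (0 : hser) = set0.
Proof. exact: supp_hzero. Qed.

Lemma supp1 : supp (1 : hser) = [set R0].
Proof. exact: supp_hmono. Qed.

Lemma suppD u v : supp (u + v) `<=` supp u `|` supp v.
Proof. exact: supp_hadd. Qed.

Lemma suppB u v : supp (u - v) `<=` supp u `|` supp v.
Proof. by rewrite -(supp_hopp v); apply: suppD. Qed.

Lemma suppM u v : supp (u * v) `<=` sumset (supp u) (supp v).
Proof. exact: supp_hmul. Qed.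

Lemma supp_sum (I : eqType) (r : seq I) (F : I -> hser) x :
  supp (\sum_(i <- r) F i) x -> exists2 i, i \in r & supp (F i) x.
Proof.
move=> sx; apply: contrapT => /forall2NP noi; apply: sx.
by rewrite coef_sumE big_seq big1 // => i ri; case: (noi i) => // /nsuppP.
Qed.

Lemma suppX u n : supp (u ^+ n) `<=` iter n (sumset (supp u)) [set R0].
Proof.
elim: n => [|n IHn] x; first by rewrite expr0 supp1.
by rewrite exprS => /suppM[a [ua /IHn]]; exists a.
Qed.

Lemma supp_tpow a (Ga : G a) : supp (tpow Ga) = [set a].
Proof. exact: supp_hmono. Qed.

Lemma coef_tpow a (Ga : G a) : tpow Ga a = 1.
Proof. by rewrite /= /hmono; case: Req_EM_T. Qed.

Lemma coef_tpowM a (Ga : G a) u x : (tpow Ga * u) x = u (x - a)%coqR.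
Proof. exact: hmul_hmono. Qed.

Lemma supp_tpowM a (Ga : G a) u x : supp (tpow Ga * u) x = supp u (x - a)%coqR.
Proof. by rewrite /supp /mkset coef_tpowM. Qed.

Lemma tpowMN a (Ga : G a) (Gna : G (- a)%coqR) u : tpow Ga * (tpow Gna * u) = u.
Proof.
by apply/hser_eq/funext => x; rewrite !coef_tpowM; congr (u _); ring.
Qed.

Lemma supp_eq0 u : supp u = set0 -> u = 0.
Proof. by move=> u0; apply/hser_eq/funext => x; apply/nsuppP; rewrite u0. Qed.

Lemma least_supp_ex u : u <> 0 -> exists m, least (supp u) m.
Proof.
move=> u0; apply: (@hser_well_ordered u) => //; apply: contrapT => /nonemptyPn.
by move/supp_eq0.
Qed.

Lemma least_suppM u v m n :
  least (supp u) m -> least (supp v) n -> least (supp (u * v)) (m + n)%coqR.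
Proof.
move=> [um m_min] [vn n_min]; split; last first.
  by move=> x /suppM[a [/m_min le_ma /n_min le_n]]; lra.
rewrite /supp /= (@hmulE_fiber _ _ _ _ [set m]).
  rewrite fsbig_set1 (_ : (m + n - m = n)%coqR); last ring.
  by apply/eqP; rewrite mulf_neq0 //; apply/eqP.
by move=> a [/m_min le_ma /n_min le_n]; rewrite /=; lra.
Qed.

Lemma least_suppX u m n : least (supp u) m -> least (supp (u ^+ n)) (INR n * m)%coqR.
Proof.
move=> um; elim: n => [|n IHn].
  by rewrite Rmult_0_l expr0 supp1; split=> // x ->; lra.
rewrite exprS S_INR (_ : (INR n + 1) * m = m + INR n * m)%coqR; last ring.
exact: least_suppM.
Qed.

Lemma least_supp_neq0 u m : least (supp u) m -> u <> 0.
Proof. by case=> um _ u0; move: um; rewrite u0 supp0. Qed.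

Lemma hser_mulf_eq0 u v : u * v = 0 -> u <> 0 -> v = 0.
Proof.
move=> uv0 /least_supp_ex[m um]; apply: contrapT => /least_supp_ex[n vn].
exact: least_supp_neq0 (least_suppM um vn) uv0.
Qed.

Lemma hser_expf_neq0 u n : u <> 0 -> u ^+ n <> 0.
Proof. by move=> /least_supp_ex[m um]; apply: least_supp_neq0 (least_suppX n um). Qed.

Definition restr_fun (P : set R) f : R -> K := fun x => if `[< P x >] then f x else 0.

Lemma supp_restr_fun P f : supp (restr_fun P f) = P `&` supp f.
Proof.
by apply/seteqP; split=> x; rewrite /supp /restr_fun /=; case: asboolP => // ? [].
Qed.

Lemma hahn_restr P u : hahn G (restr_fun P u).
Proof.
rewrite hahnE supp_restr_fun; split; first by move=> x [_ /hser_supp].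
exact: well_orderedS (@subIsetr _ _ _) (@hser_well_ordered u).
Qed.

Definition restr P u : hser := Hser (hahn_restr P u).

Lemma supp_restr P u : supp (restr P u) = P `&` supp u.
Proof. exact: supp_restr_fun. Qed.

Lemma restr_in (P : set R) u x : P x -> restr P u x = u x.
Proof. by move=> Px; rewrite /= /restr_fun asboolT. Qed.

Lemma restr_out (P : set R) u x : ~ P x -> restr P u x = 0.
Proof. by move=> nPx; rewrite /= /restr_fun asboolF. Qed.

Lemma restr_setC P u : u = restr P u + restr (~` P) u.
Proof.
apply/hser_eq/funext => x; rewrite coefDE; have [Px|nPx] := pselect (P x).
- by rewrite restr_in // restr_out ?addr0.
- by rewrite restr_out // restr_in ?add0r.
Qed.

Lemma restr_seq (s : seq R) u : uniq s ->
  u = \sum_(a <- s) restr [set a] u + restr (~` [set` s]) u.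
Proof.
move=> s_uniq; rewrite {1}(restr_setC [set` s] u); congr (_ + _).
apply/hser_eq/funext => x; rewrite coef_sumE; have [xs|nxs] := boolP (x \in s).
  rewrite restr_in // (bigD1_seq x) // restr_in // big1 ?Monoid.mulm1 // => a ax.
  by rewrite restr_out // => xa; rewrite xa eqxx in ax.
rewrite restr_out; last exact/negP.
by rewrite big_seq big1 // => a sa; rewrite restr_out // => xa; rewrite xa sa in nxs.
Qed.

Lemma restrM (P : set R) u v : (forall x a, supp u a -> P x <-> P (x - a)%coqR) ->
  restr P (u * v) = u * restr P v.
Proof.
move=> P_shift; apply/hser_eq/funext => x; rewrite hcoefM hmulE.
have [Px|nPx] := pselect (P x).
  rewrite restr_in // [LHS]hmulE; apply: eq_fsbigr => a _.
  have [->|/eqP ua] := eqVneq (u a) 0; first by rewrite !mul0r.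
  by rewrite restr_in //; apply/(P_shift x a ua).
rewrite restr_out // fsbig1 // => a _; have [->|/eqP ua] := eqVneq (u a) 0.
  by rewrite mul0r.
by rewrite restr_out ?mulr0 // => Pxa; apply: nPx; apply/(P_shift x a ua).
Qed.

End HahnRing.
Arguments hcoef {K G}.

(** * Valuation and norm *)

Section Valuation.
Variables (K : fieldType) (G : subgroup).
Implicit Types (u v : hser K G) (a b m n x : R).

Definition val_ge m u := forall x, supp u x -> m <= x.

Definition val_gt m u := forall x, supp u x -> m < x.

Lemma val_gtW m u : val_gt m u -> val_ge m u.
Proof. by move=> um x /um; lra. Qed.

Lemma val_ge_trans m n u : val_ge n u -> m <= n -> val_ge m u.
Proof. by move=> un le_mn x /un; lra. Qed.

Lemma val_ge_ex u : exists m, val_ge m u.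
Proof.
have [->|/least_supp_ex[m [_ um]]] := pselect (u = 0%R); last by exists m.
by exists 0 => x; rewrite supp0.
Qed.

Lemma val_geM u v m n : val_ge m u -> val_ge n v -> val_ge (m + n) (u * v)%R.
Proof. by move=> um vn x /suppM[a [/um ? /vn ?]]; lra. Qed.

Lemma val_geX u m (n : nat) : val_ge m u -> val_ge (INR n * m) (u ^+ n)%R.
Proof.
move=> um; elim: n => [|n IHn].
  by rewrite Rmult_0_l => x; rewrite expr0 supp1 => ->; lra.
by rewrite exprS S_INR (_ : (INR n + 1) * m = m + INR n * m);
  [apply: val_geM | ring].
Qed.

Lemma val_ge_tpow a (Ga : G a) : val_ge a (tpow K Ga).
Proof. by move=> x; rewrite supp_tpow => ->; lra. Qed.

Lemma val_gtB u v b : val_gt b (u - v)%R <-> forall x, x <= b -> u x = v x.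
Proof.
split=> [uv x le_xb|uv x].
  by apply/eqP; rewrite -subr_eq0 -coefBE; apply/eqP/nsuppP => /uv; lra.
by apply: contra_notP => /Rnot_lt_le /uv uvx; rewrite coefBE uvx subrr.
Qed.

Lemma hnorm0 : hnorm (0%R : hser K G) = 0.
Proof. by rewrite /hnorm; case: excluded_middle_informative => //= -[]. Qed.

Lemma hnorm_least u m : least (supp u) m -> hnorm u = exp (- m).
Proof.
move=> [um m_min]; rewrite /hnorm; case: excluded_middle_informative => /= [/(_ m)//|_].
rewrite /hval; set P := fun n => _; have [uh h_min] : P (epsilon (inhabits R0) P).
  by apply: epsilon_spec; exists m.
by congr (exp (- _)); apply: Rle_antisym; [apply: h_min | apply: m_min].
Qed.

Lemma hnorm_le u b : hnorm u <= exp (- b) <-> val_ge b u.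
Proof.
have [->|/least_supp_ex[m um]] := pselect (u = 0%R).
  by rewrite hnorm0; split=> _; [move=> x; rewrite supp0 | apply/Rlt_le/exp_pos].
rewrite (hnorm_least um); case: um => um m_min; split=> [le_exp x /m_min|/(_ m um) le_bm].
  have [lt_mb|] := Rlt_dec m b; last lra.
  by have := exp_increasing (- b) (- m); lra.
by have [->|ne_mb] := Req_dec b m; [lra | apply/Rlt_le/exp_increasing; lra].
Qed.

Lemma hnorm_lt u b : hnorm u < exp (- b) <-> val_gt b u.
Proof.
have [->|/least_supp_ex[m um]] := pselect (u = 0%R).
  by rewrite hnorm0; split=> _; [move=> x; rewrite supp0 | apply: exp_pos].
rewrite (hnorm_least um); case: um => um m_min.
by split=> [/exp_lt_inv lt_bm x /m_min|/(_ m um) lt_bm]; [lra | apply: exp_increasing; lra].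
Qed.

End Valuation.

(** * Frobenius *)

Lemma pchar_gt0 (K : fieldType) (p : nat) : p \in GRing.pchar K -> (0 < p)%N.
Proof. by move=> /pcharf_prime/prime_gt0. Qed.

Section Frobenius.
Variables (K : fieldType) (G : subgroup) (p : nat).
Hypothesis charKp : p \in GRing.pchar K.
Implicit Types (u v : hser K G) (x : R).
Local Open Scope ring_scope.

Lemma hser_pchar : p \in GRing.pchar (hser K G).
Proof.
rewrite inE (pcharf_prime charKp); apply/eqP/hser_eq/funext => x.
have natE n : (n%:R : hser K G) x = (1 : hser K G) x *+ n.
  by elim: n => [|n IHn]; rewrite ?mulr0n // !mulrS coefDE IHn.
by rewrite natE (mulrn_pchar charKp).
Qed.

Lemma frobeniusD u v : (u + v) ^+ p = u ^+ p + v ^+ p.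
Proof. exact: (pFrobenius_autD_comm hser_pchar (mulrC u v)). Qed.

Lemma frobenius_sum (I : Type) (r : seq I) (F : I -> hser K G) :
  (\sum_(i <- r) F i) ^+ p = \sum_(i <- r) F i ^+ p.
Proof.
exact: (big_morph (fun u => u ^+ p) frobeniusD (pFrobenius_aut0 hser_pchar)).
Qed.

Lemma supp_frobenius1 u (a : R) : supp u `<=` [set a] ->
  supp (u ^+ p) `<=` [set (INR p * b)%coqR | b in supp u].
Proof.
have p_gt0 := pchar_gt0 charKp.
move=> sua x up; have [b ub] : supp u !=set0.
  by move: up; rewrite -(prednK p_gt0) exprS => /suppM[b [ub _]]; exists b.
exists b => //; rewrite (iter_sumset1 sua (suppX up)).
by have -> : b = a := sua b ub.
Qed.

(* Only the finitely many exponents of u that occur in a decomposition of x into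
   a sum of p exponents contribute to the coefficient of u^p at x, and the p-th
   power of a finite sum of monomials is the sum of their p-th powers. *)
Lemma supp_frobenius u : supp (u ^+ p) `<=` [set (INR p * a)%coqR | a in supp u].
Proof.
move=> x; have wou := @hser_well_ordered _ _ u.
have /finite_seqP[s fiberE] :=
  finite_fiber x wou (@well_ordered_iter_sumset (supp u) p.-1 wou).
have sub_supp P : supp (restr P u) `<=` supp u by rewrite supp_restr => a [].
rewrite {1}(restr_seq u (undup_uniq s)) frobeniusD frobenius_sum => /suppD[|].
  move=> /supp_sum[a _ /(@supp_frobenius1 _ a)[]]; first by rewrite supp_restr => b [].
  by move=> b /sub_supp ub <-; exists b.
rewrite -(prednK (pchar_gt0 charKp)) exprS => /suppM[a [ua va]].
suff sa : a \in s by move: ua; rewrite supp_restr => -[]; rewrite /= mem_undup sa.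
suff: fiber (supp u) (iter p.-1 (sumset (supp u)) [set R0]) x a by rewrite fiberE.
split; first exact: sub_supp ua.
have iter_sub n : iter n (sumset (supp (restr (~` [set` undup s]) u))) [set R0]
    `<=` iter n (sumset (supp u)) [set R0].
  by elim: n => // n IHn y [b [/sub_supp ub /IHn]]; exists b.
exact/iter_sub/suppX.
Qed.

End Frobenius.

(** * Series with finitely many cosets of exponents *)

Definition finite_cosets (H A : R -> Prop) := exists l : list R, covered_by_cosets H l A.

Section FiniteCosets.
Variable H : subgroup.
Implicit Types A B : set R.

Lemma finite_cosetsS A B : A `<=` B -> finite_cosets H B -> finite_cosets H A.
Proof. by move=> sAB [l lB]; exists l => x /sAB /lB. Qed.

Lemma finite_cosetsU A B :
  finite_cosets H A -> finite_cosets H B -> finite_cosets H (A `|` B).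
Proof.
move=> [l lA] [m mB]; exists (l ++ m) => x [/lA|/mB] [r [rl Hr]]; exists r; split=> //;
  apply/in_or_app; by [left|right].
Qed.

Lemma finite_cosets_sumset A B :
  finite_cosets H A -> finite_cosets H B -> finite_cosets H (sumset A B).
Proof.
move=> [l lA] [m mB]; exists (List.map (fun q => q.1 + q.2) (list_prod l m)).
move=> x [a [/lA[r [rl Hr]] /mB[s [sm Hs]]]]; exists (r + s); split.
  by apply/in_map_iff; exists (r, s); split=> //; apply: in_prod.
by rewrite (_ : x - (r + s) = (a - r) + (x - a - s)); [apply: subgroupD | ring].
Qed.

Lemma finite_cosets_list A (l : list R) : (forall x, A x -> In x l) -> finite_cosets H A.
Proof.
move=> Al; exists l => x /Al xl; exists x.
by rewrite Rminus_diag; split=> //; apply: subgroup0.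
Qed.

Lemma finite_cosets_subgroup A : A `<=` H -> finite_cosets H A.
Proof.
by move=> AH; exists [:: R0] => x /AH Hx; exists R0; rewrite Rminus_0_r; split=> //; left.
Qed.

End FiniteCosets.

Section CosetSubrings.
Variables (K : fieldType) (G H : subgroup).
Implicit Types (u v : hser K G).
Local Open Scope ring_scope.

Definition exps_in : {pred hser K G} := fun u => `[< supp u `<=` H >].

Definition fin_cosets : {pred hser K G} := fun u => `[< finite_cosets H (supp u) >].

Definition loc_fin_cosets : {pred hser K G} :=
  fun u => `[< forall b, finite_cosets H (supp u `&` [set x | Rle x b]) >].

Lemma exps_inP u : reflect (supp u `<=` H) (u \in exps_in).
Proof. exact: asboolP. Qed.

Lemma fin_cosetsP u : reflect (finite_cosets H (supp u)) (u \in fin_cosets).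
Proof. exact: asboolP. Qed.

Lemma loc_fin_cosetsP u : reflect
  (forall b, finite_cosets H (supp u `&` [set x | Rle x b])) (u \in loc_fin_cosets).
Proof. exact: asboolP. Qed.

Lemma tpow_fin_cosets a (Ga : G a) : tpow K Ga \in fin_cosets.
Proof.
apply/fin_cosetsP/(finite_cosets_list H (l := [:: a])) => x.
by rewrite supp_tpow => ->; left.
Qed.

Lemma exps_in_fin_cosets : {subset exps_in <= fin_cosets}.
Proof. by move=> u /exps_inP uH; apply/fin_cosetsP/finite_cosets_subgroup. Qed.

Lemma fin_cosets_loc : {subset fin_cosets <= loc_fin_cosets}.
Proof.
by move=> u /fin_cosetsP fu; apply/loc_fin_cosetsP => b; apply: finite_cosetsS fu => x [].
Qed.

Lemma exps_in_subring : GRing.subring_closed exps_in.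
Proof.
split=> [|u v|u v].
- by apply/exps_inP; rewrite supp1 => x ->; apply: subgroup0.
- by move=> /exps_inP uH /exps_inP vH; apply/exps_inP => x /suppB[/uH|/vH].
- move=> /exps_inP uH /exps_inP vH; apply/exps_inP => x /suppM[a [/uH Ha /vH Hxa]].
  by rewrite (_ : x = a + (x - a))%coqR; [apply: subgroupD | ring].
Qed.

HB.instance Definition _ := GRing.isSubringClosed.Build (hser K G) exps_in exps_in_subring.

Lemma fin_cosets_subring : GRing.subring_closed fin_cosets.
Proof.
split=> [|u v|u v]; first exact/exps_in_fin_cosets/rpred1.
- move=> /fin_cosetsP fu /fin_cosetsP fv; apply/fin_cosetsP.
  exact: finite_cosetsS (@suppB _ _ u v) (finite_cosetsU fu fv).
- move=> /fin_cosetsP fu /fin_cosetsP fv; apply/fin_cosetsP.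
  exact: finite_cosetsS (@suppM _ _ u v) (finite_cosets_sumset fu fv).
Qed.

HB.instance Definition _ :=
  GRing.isSubringClosed.Build (hser K G) fin_cosets fin_cosets_subring.

Lemma loc_fin_cosets_subring : GRing.subring_closed loc_fin_cosets.
Proof.
split=> [|u v|u v]; first exact/fin_cosets_loc/rpred1.
- move=> /loc_fin_cosetsP fu /loc_fin_cosetsP fv; apply/loc_fin_cosetsP => b.
  apply: finite_cosetsS (finite_cosetsU (fu b) (fv b)).
  by move=> x [/suppB[ux|vx] le_xb]; [left|right].
- move=> /loc_fin_cosetsP fu /loc_fin_cosetsP fv; apply/loc_fin_cosetsP => b.
  have [[m um] [n vn]] := (val_ge_ex u, val_ge_ex v).
  apply: finite_cosetsS (finite_cosets_sumset (fu (b - n)%coqR) (fv (b - m)%coqR)).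
  move=> x [/suppM[a [ua va]] /= le_xb]; exists a.
  by have := um _ ua; have := vn _ va; do !split=> //=; lra.
Qed.

HB.instance Definition _ :=
  GRing.isSubringClosed.Build (hser K G) loc_fin_cosets loc_fin_cosets_subring.

End CosetSubrings.

(** * The compositum and its completion *)

Section Cancellation.
Variables (K : fieldType) (G H : subgroup).
Local Open Scope ring_scope.

(* Multiplication by a series with exponents in H commutes with the restriction
   to a union of cosets of H. *)
Lemma exps_in_cancel (a v : hser K G) : a \in exps_in H -> a <> 0 ->
  a * v \in fin_cosets H -> v \in fin_cosets H.
Proof.
move=> /exps_inP aH a0 /fin_cosetsP[l l_cov].
pose P := [set x : R | exists r, In r l /\ H (x - r)%coqR].
have P_shift x b : supp a b -> P x <-> P (x - b)%coqR.
  move=> /aH Hb; split=> -[r [rl Hr]]; exists r; split=> //.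
    by rewrite (_ : x - b - r = x - r - b)%coqR; [apply: subgroupB | ring].
  by rewrite (_ : x - r = x - b - r + b)%coqR; [apply: subgroupD | ring].
have restr0 : restr (~` P) v = 0.
  apply: hser_mulf_eq0 a0; rewrite -restrM => [|x b /(P_shift x b) Pxb].
    by apply: supp_eq0; rewrite supp_restr -subset0 => x [nPx /l_cov].
  by split; apply: contra_not => /Pxb.
apply/fin_cosetsP; exists l => x; rewrite (restr_setC P v) restr0 addr0 supp_restr.
by case.
Qed.

End Cancellation.

Section Compositum.
Variables (K : fieldType) (p : nat).
Hypothesis charKp : p \in GRing.pchar K.
Variable G : subgroup.
Local Notation H := (pmul_subgroup p G).
Local Notation M := (@fin_cosets K G H).
Local Notation Mhat := (@loc_fin_cosets K G H).
Implicit Types (u v w : hser K G).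
Local Open Scope ring_scope.

Lemma frobenius_exps_in u : u ^+ p \in exps_in H.
Proof.
by apply/exps_inP => x /(supp_frobenius charKp)[a /hser_supp Ga <-]; exists a.
Qed.

Lemma fin_cosets_cancel u v : u \in M -> u <> 0 -> u * v \in M -> v \in M.
Proof.
move=> fu u0 fuv; apply: (exps_in_cancel (frobenius_exps_in u)).
  exact: hser_expf_neq0.
have -> : u ^+ p * v = u ^+ p.-1 * (u * v).
  by rewrite mulrA -exprSr prednK // (pchar_gt0 charKp).
by rewrite rpredM ?rpredX.
Qed.

Lemma fin_cosets_hsubfield : hsubfield G (hcoef @` [set` M]).
Proof.
split; first by move=> _ [u _ <-]; apply: hserP.
split; first by exists 0 => //=; apply: rpred0.
split; first by exists 1 => //=; apply: rpred1.
split; first by move=> _ _ [u fu <-] [v fv <-]; exists (u + v) => //=; apply: rpredD.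
split; first by move=> _ [u fu <-]; exists (- u) => //=; rewrite rpredN.
split; first by move=> _ _ [u fu <-] [v fv <-]; exists (u * v) => //=; apply: rpredM.
move=> _ g [u fu <-] u0 hg uv1; exists (Hser hg) => //=.
apply: (fin_cosets_cancel fu) => [uE|]; first by apply: u0; rewrite uE.
by rewrite (_ : u * Hser hg = 1) ?rpred1 //; apply: hser_eq.
Qed.

Lemma hpoly_fin_cosets f : hpoly G f -> exists2 u, u \in M & hcoef u = f.
Proof.
move=> [fG [l fl]].
have wof : well_ordered (supp f).
  by apply: well_orderedS (@well_ordered_seq l) => x /fl /InP.
by exists (Hser (conj fG wof)) => //; apply/fin_cosetsP/(finite_cosets_list H fl).
Qed.

Lemma hrat_fin_cosets h : hrat G h -> exists2 w, w \in M & hcoef w = h.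
Proof.
move=> [f [g [/hpoly_fin_cosets[u fu <-] [/hpoly_fin_cosets[v fv <-] [v0 [hh vhu]]]]]].
exists (Hser hh) => //; apply: (fin_cosets_cancel fv) => [vE|].
  by apply: v0; rewrite vE.
by rewrite (_ : v * Hser hh = u) //; apply: hser_eq.
Qed.

Lemma tpow_hrat a (Ga : G a) : hrat G (tpow K Ga).
Proof.
have hpoly_mono b : G b -> hpoly G (hmono K b).
  move=> Gb; have only_b x : hmono K b x <> 0 -> x = b.
    by rewrite /hmono; case: Req_EM_T.
  by split=> [x /only_b ->|] //; exists [:: b] => x /only_b ->; left.
exists (hmono K a), (hone K); split; first exact: hpoly_mono.
split; first exact/hpoly_mono/subgroup0.
by split; [exact: hone_neq0 | split; [exact: hserP | exact: hmul1f]].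
Qed.

Section Generation.
Variable S : (R -> K) -> Prop.
Hypotheses (S_subfield : hsubfield G S)
  (S_hahn : forall g, hahn H g -> S g) (S_hrat : forall h, hrat G h -> S h).

Lemma hsubfield_coset r u : supp u `<=` [set x | H (x - r)%coqR] -> S u.
Proof.
have [_ [S0 [_ [_ [_ [SM _]]]]]] := S_subfield.
move=> uH; have [->|/least_supp_ex[a [ua _]]] := pselect (u = 0); first exact: S0.
have Ga := hser_supp ua; rewrite -(tpowMN Ga (subgroupN Ga) u).
apply: SM; first exact/S_hrat/tpow_hrat.
apply: S_hahn; rewrite hahnE; split=> [x|]; last exact: hser_well_ordered.
rewrite supp_tpowM => /uH Hx.
by rewrite (_ : x = x - - a - r - (a - r))%coqR; [apply: subgroupB => //; apply: uH | ring].
Qed.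

Lemma hsubfield_fin_cosets u : u \in M -> S u.
Proof.
have [_ [S0 [_ [SD _]]]] := S_subfield.
move=> /fin_cosetsP[l]; elim: l u => [|r l IHl] u l_cov.
  by rewrite (_ : u = 0) //; apply: supp_eq0; rewrite -subset0 => x /l_cov[r []].
rewrite (restr_setC [set x | H (x - r)%coqR] u); apply: SD.
  by apply: (@hsubfield_coset r); rewrite supp_restr => x [].
apply: IHl => x; rewrite supp_restr => -[nHx /l_cov[s [[rs|sl] Hs]]]; last by exists s.
by case: nHx; rewrite /= rs.
Qed.

End Generation.

Lemma compositumE : @compositum K p G = hcoef @` [set` M].
Proof.
apply/funext => f; apply/propext; split=> [|[u fu <-] S subS S_hahn S_hrat].
  apply; first exact: fin_cosets_hsubfield.
    move=> g [gH wog]; have hg : hahn G g.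
      by split=> // x /gH /pmul_subgroup_sub.
    by exists (Hser hg) => //; apply/exps_in_fin_cosets/exps_inP.
  exact: hrat_fin_cosets.
exact: hsubfield_fin_cosets fu.
Qed.

Lemma compositumP (f : R -> K) : compositum p G f <->
  hahn G f /\ exists l, covered_by_cosets (pmul_grp p G) l (fun x => f x <> 0).
Proof.
rewrite compositumE; split=> [[u /fin_cosetsP fu <-]|[hf fin_f]].
  by split; first exact: hserP.
by exists (Hser hf) => //; apply/fin_cosetsP.
Qed.

Lemma closure_compositumE : closure_in G (@compositum K p G) = hcoef @` [set` Mhat].
Proof.
rewrite compositumE; apply/funext => f; apply/propext.
split=> [[hf approx]|[u /loc_fin_cosetsP fu <-]].
  exists (Hser hf) => //; apply/loc_fin_cosetsP => b.
  have [_ [[v /fin_cosetsP fv <-]]] := approx _ (exp_pos (- b)).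
  rewrite -[hsub _ _]/(hcoef (Hser hf - v)) => /hnorm_lt /val_gtB fvE.
  by apply: finite_cosetsS fv => x [fx /fvE e]; rewrite /supp /= -e.
split=> [|eps eps_gt0]; first exact: hserP.
pose v := restr [set x | Rle x (- ln eps)] u; exists v; split.
  by exists v => //; apply/fin_cosetsP; rewrite supp_restr setIC.
rewrite -hcoefB -[eps]exp_ln // -[ln eps]Ropp_involutive.
by apply/hnorm_lt/val_gtB => x le_x; rewrite restr_in.
Qed.

Lemma frobenius_annihilator u : exists q : {poly hser K G},
  [/\ q \is a polyOver (exps_in H), q != 0 & root q u].
Proof.
exists ('X^p - (u ^+ p)%:P); split.
- by rewrite rpredB ?polyOverXn // polyOverC frobenius_exps_in.
- by rewrite monic_neq0 // monicXnsubC // (pchar_gt0 charKp).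
- by rewrite rootE !hornerE subrr.
Qed.

Lemma hhorner_map (s : seq (hser K G)) u :
  hhorner (List.map hcoef s) u = hcoef (horner_rec s u).
Proof.
by elim: s => // c s /= ->; rewrite -hcoefM -hcoefD addrC.
Qed.

Lemma hahn_algebraic f : hahn G f -> exists cs : list (R -> K),
  (forall c, In c cs -> hahn H c) /\ (exists c, In c cs /\ c <> hzero K) /\
  hhorner cs f = hzero K.
Proof.
move=> hf; have [q [/polyOverP qH q0 /eqP qu0]] := frobenius_annihilator (Hser hf).
exists (List.map hcoef q); split; last split.
- move=> _ /in_map_iff[w [<- /InP/(nthP 0)[i _ <-]]].
  by split; [apply/exps_inP/qH | apply: hser_well_ordered].
- exists (hcoef (lead_coef q)); split.
    apply/in_map_iff; exists (lead_coef q); split=> //; apply/InP/mem_nth.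
    by rewrite prednK // size_poly_gt0.
  by move=> e; move: q0; rewrite -lead_coef_eq0 => /eqP; apply; apply: hser_eq.
- by rewrite -[f]/(hcoef (Hser hf)) hhorner_map -/(horner q _) qu0.
Qed.

End Compositum.

(** * Incongruent sequences in a subgroup of infinite index *)

Definition incongruent (H : R -> Prop) (s : nat -> R) :=
  forall i j, i <> j -> ~ H (s i - s j).

Lemma incongruent_not_finite_cosets (H : subgroup) (s : nat -> R) :
  incongruent H s -> ~ finite_cosets H (range s).
Proof.
move=> s_inc [l l_cov].
have /choice[r rP] n : exists r, In r l /\ H (s n - r) by apply: l_cov; exists n.
have r_inj : injective r.
  move=> i j rij; apply: contrapT => /s_inc; apply.
  have [[_ Hi] [_ Hj]] := (rP i, rP j).
  rewrite (_ : s i - s j = s i - r i - (s j - r j)); first exact: subgroupB.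
  by rewrite rij; ring.
have : (size (mkseq r (size l).+1) <= size l)%N.
  apply: uniq_leq_size; first exact: mkseq_uniq.
  by move=> _ /mapP[n _ ->]; apply/InP; case: (rP n).
by rewrite size_mkseq ltnn.
Qed.

Definition nondiscrete (G : R -> Prop) := forall e, 0 < e -> exists g, G g /\ 0 < g < e.

Section Density.
Variable G : subgroup.

Lemma subgroup_dense a b : nondiscrete G -> a < b ->
  exists g, G g /\ a < g < b.
Proof.
move=> small lt_ab; have [|g [Gg [g_gt0 g_lt]]] := small (b - a); first lra.
have [k [r [aE]]] := euclidian_division a g (Rgt_not_eq _ _ g_gt0).
rewrite Rabs_pos_eq; last lra.
move=> [r_ge0 r_lt]; exists (IZR k * g + g); split; last lra.
by apply: subgroupD => //; apply: subgroup_intmul.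
Qed.

Variable p : nat.
Hypothesis p_gt0 : (0 < p)%N.
Local Notation H := (pmul_subgroup p G).
Hypothesis infinite_index : ~ finite_cosets H G.

Lemma INRp_gt0 : 0 < INR p.
Proof. exact/lt_0_INR/ltP. Qed.

(* Otherwise an interval of length e contains at most one element of G; then
   bounded parts of G are finite, and they meet all cosets of a nonzero element
   of pG. *)
Lemma infinite_index_nondiscrete : nondiscrete G.
Proof.
move=> e e_gt0; apply: contrapT => nosmall; apply: infinite_index.
have short a : finite_cosets H (G `&` [set x | a <= x < a + e]).
  have [[y [Gy ay]]|empty] := pselect (G `&` [set x | a <= x < a + e] !=set0); last first.
    by apply: (finite_cosets_list H (l := [::])) => x Ix; case: empty; exists x.
  apply: (finite_cosets_list H (l := [:: y])) => x [Gx ax]; left.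
  move: ay ax => /= ay ax; have [//|[lt_xy|lt_yx]] : y = x \/ x < y \/ y < x by lra.
  - by case: nosmall; exists (y - x); split; [exact: subgroupB | lra].
  - by case: nosmall; exists (x - y); split; [exact: subgroupB | lra].
have bounded n : finite_cosets H (G `&` [set x | 0 <= x < INR n * e]).
  elim: n => [|n IHn].
    by apply: (finite_cosets_list H (l := [::])) => x [_ /=]; lra.
  apply: finite_cosetsS (finite_cosetsU IHn (short (INR n * e))) => x [Gx].
  rewrite S_INR /= => x_bd; have [lt_x|le_x] := Rlt_le_dec x (INR n * e).
  - by left; split=> //=; lra.
  - by right; split=> //=; lra.
have [[g [Gg g_gt0]]|nopos] := pselect (exists g, G g /\ 0 < g); last first.
  apply: (finite_cosets_list H (l := [:: R0])) => x Gx; left.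
  have [//|[x_lt0|x_gt0]] : 0 = x \/ x < 0 \/ 0 < x by lra.
  - by case: nopos; exists (- x); split; [exact: subgroupN | lra].
  - by case: nopos; exists x.
have pg_gt0 : 0 < INR p * g by apply: Rmult_lt_0_compat => //; apply: INRp_gt0.
have [n lt_n] := INR_archimed e (INR p * g) e_gt0.
have H_fin : finite_cosets H H by apply: finite_cosets_subgroup.
apply: finite_cosetsS (finite_cosets_sumset H_fin (bounded n)) => x Gx.
have [k [r [xE]]] := euclidian_division x (INR p * g) (Rgt_not_eq _ _ pg_gt0).
rewrite Rabs_pos_eq; last lra.
move=> r_bd; have Hk : H (IZR k * (INR p * g)).
  by apply: subgroup_intmul; exists g.
exists (IZR k * (INR p * g)); split=> //; have rE : x - IZR k * (INR p * g) = r by lra.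
split; first by apply: subgroupB => //; apply: pmul_subgroup_sub Hk.
by rewrite rE /=; lra.
Qed.

Lemma pmul_dense a b : a < b -> exists h, H h /\ a < h < b.
Proof.
move=> lt_ab; have p_pos := INRp_gt0.
have scale x : INR p * (x / INR p) = x by field; lra.
have [|g [Gg [lt_ag lt_gb]]] :=
  @subgroup_dense (a / INR p) (b / INR p) infinite_index_nondiscrete.
  by apply: (Rmult_lt_reg_l (INR p)) => //; rewrite !scale.
exists (INR p * g); split; first by exists g.
by rewrite -{1}(scale a) -(scale b); split; apply: Rmult_lt_compat_l.
Qed.

Lemma incongruent_dense (s : seq R) a b : a < b ->
  exists g, [/\ G g, a < g < b & forall r, r \in s -> ~ H (g - r)].
Proof.
move=> lt_ab; have [g [Gg g_inc]] : exists g, G g /\ forall r, r \in s -> ~ H (g - r).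
  apply: contrapT => ng; apply: infinite_index; exists s => x Gx; apply: contrapT => nx.
  by apply: ng; exists x; split=> // r /InP sr Hxr; apply: nx; exists r.
have [|h [Hh h_bd]] := @pmul_dense (a - g) (b - g); first lra.
exists (g + h); split=> [||r sr Hghr].
- by apply: subgroupD => //; apply: pmul_subgroup_sub Hh.
- lra.
- by apply: (g_inc r sr); rewrite (_ : g - r = g + h - r - h); [apply: subgroupB | ring].
Qed.

Lemma increasing_incongruent_sequence a b : a < b -> exists s : nat -> R,
  [/\ forall n, G (s n), forall n, a < s n < b, forall n, s n < s n.+1 & incongruent H s].
Proof.
move=> lt_ab; pose bound n := b - (b - a) * (/ 2) ^ n.
have pow_gt0 n : 0 < (/ 2) ^ n by apply: pow_lt; lra.
have bound_lt n : bound n < bound n.+1.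
  by rewrite /bound /=; have := Rmult_lt_0_compat (b - a) _ _ (pow_gt0 n); lra.
have [s sP] := history_choice (fun t => incongruent_dense t (bound_lt (size t))).
have G_s n : G (s n) by case: (sP n).
have s_bd n : bound n < s n < bound n.+1 by case: (sP n); rewrite size_mkseq.
have s_new i j : (i < j)%N -> ~ H (s j - s i).
  by move=> lt_ij; case: (sP j) => _ _; apply; apply/mapP; exists i; rewrite ?mem_iota.
exists s; split=> // [n|n|i j ne_ij Hij].
- have bound0 : bound 0%N = a by rewrite /bound /=; ring.
  have : bound n >= bound 0%N.
    by apply: growing_prop; [move=> k; have := bound_lt k; lra | apply/leP].
  have := s_bd n; have := Rmult_lt_0_compat (b - a) _ _ (pow_gt0 n.+1).
  by rewrite bound0 {2}/bound; lra.
- by have := s_bd n; have := s_bd n.+1; lra.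
- case: (ltngtP i j) => [lt_ij|lt_ji|//]; last exact: s_new Hij.
  by apply: (s_new i j lt_ij); rewrite -Ropp_minus_distr; apply: subgroupN.
Qed.

End Density.

(** * Spherical completeness *)

Section PseudoLimit.
Variables (K : fieldType) (G : subgroup).
Variables (t : nat -> R) (c : nat -> hser K G).
Hypothesis t_growing : Un_growing t.
Hypothesis c_cauchy : forall n, val_gt (t n) (c n.+1 - c n)%R.

Lemma pseudo_cauchy_stable m n x : (m <= n)%N -> x <= t m -> c n x = c m x.
Proof.
move=> /subnKC <- le_x; elim: (n - m)%N => [|k IHk]; first by rewrite addn0.
have /val_gtB step := @c_cauchy (m + k)%N; rewrite addnS step //.
by have := growing_prop t (m + k) m t_growing (leP (leq_addr k m)); lra.
Qed.

Lemma pseudo_limit : exists y : hser K G, forall n, val_gt (t n) (y - c n)%R.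
Proof.
have /choice[f fP] x : exists k, (forall n, x <= t n -> k = c n x) /\
    (k <> 0%R -> exists n, x <= t n).
  have [[n le_x]|none] := pselect (exists n, x <= t n); last first.
    by exists 0%R; split=> // n le_x; case: none; exists n.
  exists (c n x); split=> [m le_x'|_]; last by exists n.
  case: (leqP m n) => [le_mn|/ltnW le_nm]; first exact: pseudo_cauchy_stable.
  by rewrite (pseudo_cauchy_stable le_nm).
have f_eq n x : x <= t n -> f x = c n x by case: (fP x) => f_eq _; apply: f_eq.
have supp_f x : supp f x -> exists n, x <= t n by case: (fP x).
have hf : hahn G f.
  rewrite hahnE; split=> [x fx|T sT [y Ty]].
    have [n /f_eq fE] := supp_f x fx.
    by apply: (@hser_supp _ _ (c n)); rewrite /supp /= -fE.
  have [n le_y] := supp_f y (sT y Ty).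
  have [||m [[Tm le_m] m_min]] := @hser_well_ordered _ _ (c n) (T `&` [set x | x <= y]).
  - by move=> x [/sT fx /= le_xy]; rewrite /supp /= -f_eq //; lra.
  - by exists y; split=> //=; lra.
  exists m; split=> // x Tx; have [lt_yx|le_xy] := Rlt_le_dec y x; last exact: m_min.
  by move: le_m => /=; lra.
by exists (Hser hf) => n; apply/val_gtB => x; apply: f_eq.
Qed.

End PseudoLimit.

Section NotSphericallyComplete.
Variables (K : fieldType) (G H : subgroup).
Local Notation Mhat := (@loc_fin_cosets K G H).
Variables (s : nat -> R) (b : R).
Hypotheses (G_s : forall n, G (s n)) (s_lt : forall n, s n < s n.+1).
Hypotheses (s_ub : forall n, s n <= b) (s_inc : incongruent H s).

Lemma loc_fin_cosets_gap u : u \in Mhat -> ~ forall n, supp u (s n).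
Proof.
move=> /loc_fin_cosetsP/(_ b) fu us; apply: (incongruent_not_finite_cosets s_inc).
by apply: finite_cosetsS fu => _ [n _ <-]; split; [apply: us | apply: s_ub].
Qed.

(* A limit of the partial sums of the t^(s i) has all the s i as exponents. *)
Lemma loc_fin_cosets_not_spherically_complete :
  ~ spherically_complete (hcoef @` [set` Mhat]).
Proof.
move=> sph; pose c n : hser K G := (\sum_(i < n) tpow K (G_s i))%R.
have cS n : c n.+1 = (c n + tpow K (G_s n))%R by rewrite /c big_ord_recr.
have c_coef n : c n.+1 (s n) = 1%R.
  rewrite /c big_ord_recr coefDE coef_sumE coef_tpow big1 ?add0r // => i _.
  have ne_ni : n <> i by move=> ni; have := ltn_ord i; rewrite -ni ltnn.
  apply/nsuppP; rewrite supp_tpow => /= s_ni.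
  by case: (s_inc ne_ni); rewrite s_ni Rminus_diag; apply: subgroup0.
have [n|n|n _ [u _ <-]|_ [[u uM <-] u_lim]] :=
  sph (fun n => hcoef (c n)) (fun n => exp (- s n)).
- exists (c n) => //; apply/rpred_sum => i _; exact/fin_cosets_loc/tpow_fin_cosets.
- exact/Rlt_le/exp_pos.
- rewrite -!hcoefB => /hnorm_le un; apply/hnorm_le => x.
  have -> : (u - c n = u - c n.+1 + tpow K (G_s n))%R by rewrite cS opprD addrA subrK.
  by case/suppD=> [/un|]; [have := s_lt n; lra | rewrite supp_tpow => ->; lra].
apply: (loc_fin_cosets_gap uM) => n; rewrite /supp /=.
have /hnorm_le un : hnorm (hcoef (u - c n.+1)%R) <= exp (- s n.+1) := u_lim n.+1.
have -> : u (s n) = c n.+1 (s n).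
  by apply: (val_gtB u (c n.+1) (s n)).1 => [x /un|]; have := s_lt n; lra.
by rewrite c_coef; apply/eqP; rewrite oner_eq0.
Qed.

End NotSphericallyComplete.

(** * Bounded maps into the completion *)

Section BoundedMaps.
Variables (K : fieldType) (p : nat).
Hypothesis charKp : p \in GRing.pchar K.
Variable G : subgroup.
Local Notation H := (pmul_subgroup p G).
Local Notation Mhat := (@loc_fin_cosets K G H).
Hypothesis infinite_index : ~ finite_cosets H G.
Variable Phi : hser K G -> hser K G.
Hypotheses (Phi_Mhat : forall y, Phi y \in Mhat)
  (PhiD : forall y z, Phi (y + z)%R = (Phi y + Phi z)%R)
  (PhiZ : forall a y, a \in Mhat -> Phi (a * y)%R = (a * Phi y)%R).

(* The operator norm of Phi is at most exp k. *)
Definition val_bound k := forall m y, val_ge m y -> val_ge (m - k) (Phi y).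

Definition nearly_attained k d :=
  exists y m n, [/\ val_ge m y, least (supp (Phi y)) n & k - d < m - n].

Lemma tpow_Mhat a (Ga : G a) : tpow K Ga \in Mhat.
Proof. exact/fin_cosets_loc/tpow_fin_cosets. Qed.

Lemma least_val_bound k0 y0 : val_bound k0 -> Phi y0 <> 0%R ->
  exists k, val_bound k /\ forall d, 0 < d -> nearly_attained k d.
Proof.
move=> k0_bound Phi_y0.
pose loss r := exists y m n, [/\ val_ge m y, least (supp (Phi y)) n & r = m - n].
have [||k [k_ub k_lub]] := completeness loss.
- by exists k0 => _ [y [m [n [ym [yn _] ->]]]]; have := k0_bound m y ym n yn; lra.
- have [[m ym] [n yn]] := (val_ge_ex y0, least_supp_ex Phi_y0).
  by exists (m - n), y0, m, n.
exists k; split=> [m y ym x yx|d d_gt0].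
  have [n yn] : exists n, least (supp (Phi y)) n.
    by apply: least_supp_ex => Phi0; move: yx; rewrite Phi0 supp0.
  have : m - n <= k by apply: k_ub; exists y, m, n.
  by case: yn => _ /(_ x yx); lra.
apply: contrapT => none; suff : k <= k - d by lra.
apply: k_lub => _ [y [m [n [ym yn ->]]]]; apply: Rnot_lt_le => lt_k; apply: none.
by exists y, m, n.
Qed.

(* If v(u) - v(Phi u) > k - d and q = v(Phi u), then t^(r - p q) (Phi u)^(p - 1) u
   is mapped to t^(r - p q) (Phi u)^p, whose exponents lie in r + pG. *)
Lemma norming_element k d r : G r -> nearly_attained k d ->
  exists e, [/\ val_gt (k - d + r) e, supp (Phi e) r &
               supp (Phi e) `<=` [set x | H (x - r)]].
Proof.
have p_gt0 := pchar_gt0 charKp.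
move=> Gr [u [m [q [um wq lt_k]]]]; pose w := Phi u; rewrite -/w in wq.
have Gq : G q by apply: (@hser_supp _ _ w); case: wq.
have Hpq : H (INR p * q) by exists q.
have Gshift : G (r - INR p * q) by apply: subgroupB => //; apply: subgroup_natmul.
pose a := (tpow K Gshift * w ^+ p.-1)%R.
have Phi_au : Phi (a * u)%R = (tpow K Gshift * w ^+ p)%R.
  rewrite PhiZ -/w ?rpredM ?rpredX ?tpow_Mhat ?Phi_Mhat //.
  by rewrite /a -mulrA -exprSr prednK.
exists (a * u)%R; split.
- have au_ge : val_ge (r - INR p * q + INR p.-1 * q + m) (a * u)%R.
    by do 2!apply: val_geM => //; [apply: val_ge_tpow | apply: val_geX; case: wq].
  have p_pred : INR p = INR p.-1 + 1 by rewrite -S_INR prednK.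
  by move=> x /au_ge; rewrite p_pred; lra.
- rewrite Phi_au supp_tpowM (_ : r - (r - INR p * q) = INR p * q); last ring.
  by case: (least_suppX p wq).
- move=> x; rewrite Phi_au supp_tpowM => wx.
  have /exps_inP/(_ _ wx) Hx := frobenius_exps_in charKp w.
  rewrite /mkset (_ : x - r = x - (r - INR p * q) - INR p * q); last ring.
  exact: subgroupB.
Qed.

(* For an optimal bound k choose e_n of valuation above k + s_n such that Phi e_n
   has an exponent s_(n+1) and all its exponents in s_(n+1) + pG: a pseudo-limit
   of the partial sums of the e_n is mapped to a series with all these exponents. *)
Lemma bounded_linear_eq0 y : (exists k, val_bound k) -> Phi y = 0%R.
Proof.
have [s [G_s s_bd s_lt s_inc]] :=
  increasing_incongruent_sequence (pchar_gt0 charKp) infinite_index Rlt_0_1.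
move=> [k0 k0_bound]; apply: contrapT => /(least_val_bound k0_bound)[k [k_bound k_opt]].
have /choice[e eP] n : exists e, [/\ val_gt (k + s n) e, supp (Phi e) (s n.+1) &
    supp (Phi e) `<=` [set x | H (x - s n.+1)]].
  have [|e [e_gt e_supp e_cos]] := norming_element (G_s n.+1) (k_opt (s n.+1 - s n) _).
    by have := s_lt n; lra.
  by exists e; split=> // x /e_gt; lra.
pose c n := (\sum_(i < n) e i)%R.
have [|n|z z_lim] := @pseudo_limit _ _ (fun n => k + s n) c.
- by move=> n; have := s_lt n; lra.
- by rewrite /c big_ord_recr addrC addKr; case: (eP n).
have Phi0 : Phi 0%R = 0%R by rewrite -[X in Phi X](mul0r 0%R) PhiZ ?mul0r ?rpred0.
have Phi_c n : Phi (c n) = (\sum_(i < n) Phi (e i))%R := big_morph Phi PhiD Phi0 _ _ _.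
have s_S_inc : incongruent H (fun n => s n.+1) by move=> i j ij; apply: s_inc => -[].
have s_S_ub n : s n.+1 <= 1 by have := s_bd n.+1; lra.
apply: (loc_fin_cosets_gap s_S_ub s_S_inc (Phi_Mhat z)) => n.
have rest_coef : Phi (z - c n.+2)%R (s n.+1) = 0%R.
  apply/nsuppP => /(k_bound _ _ (val_gtW (z_lim n.+2))).
  by have := s_lt n.+1; lra.
have other_coef i : i <> n -> Phi (e i) (s n.+1) = 0%R.
  move=> ne_in; apply/nsuppP; case: (eP i) => _ _ e_cos /e_cos.
  by apply: s_S_inc; apply: nesym.
rewrite -[z](subrK (c n.+2)) PhiD /supp /mkset coefDE rest_coef add0r Phi_c coef_sumE.
rewrite !big_ord_recr /= big1 => [|i _]; last first.
  by apply: other_coef => in_eq; have := ltn_ord i; rewrite in_eq ltnn.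
by rewrite add0r (other_coef n.+1) ?addr0; [case: (eP n) | exact/eqP/negbT/gtn_eqF].
Qed.

Lemma continuous_bounded :
  (exists D, forall y, val_ge D y -> val_gt 0 (Phi y)) -> exists k, val_bound k.
Proof.
have G_nondiscrete := infinite_index_nondiscrete (pchar_gt0 charKp) infinite_index.
move=> [D D_cont]; exists (D + 1) => m y ym x yx.
have [|c [Gc [lt_c c_lt]]] := @subgroup_dense G (D - m) (D - m + 1) G_nondiscrete.
  lra.
suff: 0 < x + c by lra.
apply: (D_cont (tpow K Gc * y)%R).
  by apply: val_ge_trans (val_geM (@val_ge_tpow _ _ c Gc) ym) _; lra.
by rewrite PhiZ ?tpow_Mhat // supp_tpowM (_ : x + c - c = x) //; ring.
Qed.

End BoundedMaps.

(** * Continuous linear maps on the p-th roots *)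

Section RootMap.
Variables (K : fieldType) (p : nat).
Hypothesis charKp : p \in GRing.pchar K.
Variable G : subgroup.
Local Notation H := (pmul_subgroup p G).
Local Notation Mhat := (@loc_fin_cosets K G H).
Hypothesis infinite_index : ~ finite_cosets H G.
Variable L : (R -> K) -> (R -> K).
Hypothesis L_root_map : cont_linear_root_map p (hcoef @` [set` Mhat]) L.
Implicit Types (a y z : hser K G).

Section Line.
Variable X : hser K G.
Hypothesis X_Mhat : X \in Mhat.

Lemma frobenius_mul_Mhat y : (y ^+ p * X)%R \in Mhat.
Proof. by rewrite rpredM //; apply/fin_cosets_loc/exps_in_fin_cosets/frobenius_exps_in. Qed.

(* In terms of p-th roots Phi is the restriction of L to the line spanned by
   X^(1/p), on which all of K((t^G)) acts since K((t^G))^p is contained in M. *)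
Lemma root_map_line : exists Phi : hser K G -> hser K G,
  forall y, Phi y \in Mhat /\ hcoef (Phi y) = L (y ^+ p * X)%R.
Proof.
have [L_Mhat _] := L_root_map.
have /choice[Phi PhiP] y : exists z, z \in Mhat /\ hcoef z = L (y ^+ p * X)%R.
  have [|z zM zE] := L_Mhat (y ^+ p * X)%R; last by exists z.
  by exists (y ^+ p * X)%R => //; apply: frobenius_mul_Mhat.
by exists Phi.
Qed.

Variable Phi : hser K G -> hser K G.
Hypothesis PhiE : forall y, hcoef (Phi y) = L (y ^+ p * X)%R.

Lemma root_map_lineD y z : Phi (y + z)%R = (Phi y + Phi z)%R.
Proof.
have [_ [LD _]] := L_root_map.
apply: hser_eq; rewrite hcoefD !PhiE (frobeniusD charKp) mulrDl hcoefD.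
by apply: LD; [exists (y ^+ p * X)%R | exists (z ^+ p * X)%R] => //;
  apply: frobenius_mul_Mhat.
Qed.

Lemma root_map_lineZ a y : a \in Mhat -> Phi (a * y)%R = (a * Phi y)%R.
Proof.
have [_ [_ [LZ _]]] := L_root_map.
move=> aM; apply: hser_eq; rewrite hcoefM !PhiE exprMn -mulrA hcoefM hcoefX.
by apply: LZ; [exists a | exists (y ^+ p * X)%R => //; apply: frobenius_mul_Mhat].
Qed.

Lemma root_map_line0 : Phi 0%R = 0%R.
Proof. by apply: (addrI (Phi 0%R)); rewrite -root_map_lineD !addr0. Qed.

Lemma root_map_line_continuous : exists D, forall y, val_ge D y -> val_gt 0 (Phi y).
Proof.
have p_gt0 := INRp_gt0 (pchar_gt0 charKp).
have [_ [_ [_ L_cont]]] := L_root_map.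
have L0 : L (0%R : hser K G) = hcoef (Phi 0%R).
  by rewrite PhiE expr0n eqn0Ngt (pchar_gt0 charKp) mul0r.
have [||delta [delta_gt0 L_delta]] := L_cont (0%R : hser K G) _ 1; [|exact: Rlt_0_1|].
  by exists 0%R => //; rewrite /= rpred0.
have [m Xm] := val_ge_ex X.
exists ((1 - INR p * ln delta - m) / INR p) => y yD.
have z_ge : val_ge (1 - INR p * ln delta) (y ^+ p * X)%R.
  by apply: val_ge_trans (val_geM (val_geX (n := p) yD) Xm) _; right; field; lra.
(* The series 0 is treated apart, as Rpower 0 (/ INR p) = 1. *)
have [z0|nz0] := pselect (y ^+ p * X = 0)%R.
  suff -> : Phi y = 0%R by move=> x; rewrite supp0.
  by apply: hser_eq; rewrite PhiE z0 L0 root_map_line0.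
apply/hnorm_lt; rewrite Ropp_0 exp_0 -[Phi y]subr0 -root_map_line0 hcoefB -L0 PhiE.
apply: L_delta; first by exists (y ^+ p * X)%R => //; apply: frobenius_mul_Mhat.
rewrite -hcoefB subr0; have [q zq] := least_supp_ex nz0.
rewrite (hnorm_least zq) /Rpower ln_exp -[X in _ < X](exp_ln delta) //.
apply: exp_increasing; apply: (Rmult_lt_reg_l (INR p)) => //.
rewrite -Rmult_assoc Rinv_r ?Rmult_1_l; last lra.
by have := z_ge q (proj1 zq); lra.
Qed.

End Line.

Lemma root_map_eq0 X : X \in Mhat -> L X = hzero K.
Proof.
move=> X_Mhat; have [Phi /all_and2[Phi_Mhat PhiE]] := root_map_line X_Mhat.
have PhiD := root_map_lineD X_Mhat PhiE; have PhiZ := root_map_lineZ X_Mhat PhiE.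
have Phi_bounded : exists k, val_bound Phi k.
  apply: (continuous_bounded charKp infinite_index PhiZ).
  exact: (root_map_line_continuous X_Mhat PhiE).
have Phi1 : Phi 1%R = 0%R.
  exact: (bounded_linear_eq0 charKp infinite_index Phi_Mhat PhiD PhiZ).
by rewrite -[X]mul1r -(expr1n _ p) -PhiE Phi1.
Qed.

End RootMap.

Theorem mainTheorem7 (K : fieldType) (p : nat)
  (hp : prime p) (hchar : p \in GRing.pchar K)
  (G : R -> Prop) (hG : add_subgroup G)
  (hinf : ~ exists l : list R, covered_by_cosets (pmul_grp p G) l G) :
  (* (i) *)
  (exists r : nat -> R,
     (forall i, G (r i)) /\ (exists B, forall i, Rabs (r i) <= B) /\
     (forall i j, i <> j -> ~ pmul_grp p G (r i - r j))) /\
  (* (ii) *)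
  (forall f : R -> K, compositum p G f ->
     exists cs : list (R -> K),
       (forall c, In c cs -> hahn (pmul_grp p G) c) /\
       (exists c, In c cs /\ c <> hzero K) /\
       hhorner cs f = hzero K) /\
  (forall f : R -> K, compositum p G f <->
     (hahn G f /\ exists l : list R,
        covered_by_cosets (pmul_grp p G) l (fun x => f x <> GRing.zero))) /\
  (* (iii) *)
  ~ spherically_complete (K:=K) (closure_in G (compositum p G)) /\
  (* (iv) *)
  (forall L : (R -> K) -> (R -> K),
     cont_linear_root_map p (closure_in G (compositum p G)) L ->
     forall x, closure_in G (compositum p G) x -> L x = hzero K).
Proof.
rewrite -[G]/(subgroup_set (Subgroup hG)) in hinf *.
move: (Subgroup hG) hinf => {hG}G infinite_index.
have [s [G_s s_bd s_lt s_inc]] :=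
  increasing_incongruent_sequence (prime_gt0 hp) infinite_index Rlt_0_1.
split.
  by exists s; do !split=> //; exists 1 => n; apply: Rabs_le; have := s_bd n; lra.
split; first by move=> f /(compositumP hchar)[hf _]; apply: hahn_algebraic hf.
split; first exact: compositumP.
rewrite (closure_compositumE hchar); split=> [|L L_root_map _ [X X_Mhat <-]].
  have s_ub n : s n <= 1 by have := s_bd n; lra.
  exact: loc_fin_cosets_not_spherically_complete G_s s_lt s_ub s_inc.
exact: (root_map_eq0 hchar infinite_index L_root_map X_Mhat).
Qed.
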